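(* Let $p$ be a probability distribution over the joint assignments to a finite set $\mathcal{V}$ of discrete random variables, let $sq$ be a probability distribution over the set of legal statistical queries over $\mathcal{V}$, and let $B$ be a fixed Bayesian net over $\mathcal{V}$. Let $0<\epsilon,\delta<1$. Let $S_{SQ}=\{(\mathbf{x}_i;\mathbf{y}_i)\}_i$ be a sample of $$M_{SQ}=M_{SQ}(\epsilon,\delta)=\left\lceil\frac{2}{\epsilon^2}\ln\frac{4}{\delta}\right\rceil$$ unlabeled statistical queries drawn independently at random from $sq$. Next, let $S_D$ be the collection of complete examples (full assignments to $\mathcal{V}$) drawn sequentially and independently from $p$, stopping as soon as $S_D$ includes, for each $i$, at least $$M'_D(\epsilon,\delta)=\frac{8}{\epsilon^2}\ln\frac{2M_{SQ}}{\delta}$$ examples that match $\mathbf{y}_i$. Let $\hat p^{(S_D)}(\mathbf{x}_i\mid\mathbf{y}_i)$ be the empirically observed estimate of $p(\mathbf{x}_i\mid\mathbf{y}_i)$ based on $S_D$, and let $$\overline{\mathrm{err}}^{S_{SQ},S_D}(B)=\frac{1}{|S_{SQ}|}\sum_{\langle\mathbf{x},\mathbf{y}\rangle\in S_{SQ}}\left[B(\mathbf{x}\mid\mathbf{y})-\hat p^{(S_D)}(\mathbf{x}\mid\mathbf{y})\right]^2 .$$ Then $$P\left[\,\left|\overline{\mathrm{err}}^{S_{SQ},S_D}(B)-\mathrm{err}(B)\right|<\epsilon\,\right]\ \geq\ 1-\delta .$$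
   Context: $\mathcal{V}=\{V_1,\dots,V_N\}$ is a finite set of random variables, each with a finite domain, with a fixed underlying joint distribution $p$. A (legal) statistical query is a pair $(\mathbf{X}=\mathbf{x};\mathbf{Y}=\mathbf{y})$, abbreviated $(\mathbf{x};\mathbf{y})$, where $\mathbf{X},\mathbf{Y}\subset\mathcal{V}$ are disjoint (possibly empty) subsets, $\mathbf{x},\mathbf{y}$ are assignments to them, and $p(\mathbf{Y}=\mathbf{y})>0$; it asks for the value $p(\mathbf{x}\mid\mathbf{y})=p(\mathbf{X}=\mathbf{x}\mid\mathbf{Y}=\mathbf{y})$. Because queries are legal, the sequential collection of $S_D$ terminates with probability 1. $sq(\mathbf{x};\mathbf{y})$ denotes the probability, under $sq$, that the query is asked; $sq$ need not be related to $p$. An example matches $\mathbf{y}$ if it assigns the values $\mathbf{y}$ to the variables $\mathbf{Y}$; the empirical estimate $\hat p^{(S_D)}(\mathbf{x}\mid\mathbf{y})$ is the fraction, among the examples in $S_D$ that match $\mathbf{y}$, of those that also match $\mathbf{x}$. A Bayesian net $B$ over $\mathcal{V}$ is a directed acyclic graph on $\mathcal{V}$ with a conditional probability table for each node given its parents; $B(\mathbf{x}\mid\mathbf{y})\in[0,1]$ denotes the conditional probability that $B$ returns for the query. The score (error) of $B$ is $$\mathrm{err}(B)=\sum_{\mathbf{x},\mathbf{y}} sq(\mathbf{x};\mathbf{y})\,[B(\mathbf{x}\mid\mathbf{y})-p(\mathbf{x}\mid\mathbf{y})]^2,$$ the sum being over all assignments to all (disjoint) subsets $\mathbf{X},\mathbf{Y}$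 of variables. *)

(* Defs.v *)
From HB Require Import structures.
From mathcomp Require Import all_boot all_order all_algebra finmap.
From mathcomp Require Import all_classical all_reals all_analysis.

Set Implicit Arguments.
Unset Strict Implicit.
Unset Printing Implicit Defensive.

Import Order.TTheory GRing.Theory Num.Theory.

Local Open Scope classical_set_scope.
Local Open Scope ring_scope.

Definition is_pmf (R : realType) (A : finType) (f : A -> R) : Prop :=
  (forall a, 0 <= f a) /\ \sum_(a : A) f a = 1.

Section Probability.
Context (R : realType) (d : measure_display) (Omega : measurableType d).
Context (P : probability Omega R).

(* The sigma-algebra generated by X when A carries its discrete one. *)
Definition sigma_of (A : finType) (X : Omega -> A) : set (set Omega) :=
  preimage_set_system [set: Omega] X [set: set A].

Definition has_law (A : finType) (X : Omega -> A) (f : A -> R) : Prop :=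
  sigma_of X `<=` measurable /\
  forall a, P (X @^-1` [set a]) = (f a)%:E.

Definition mutually_independent (I : choiceType) (F : I -> set (set Omega)) :
    Prop :=
  forall (J : {fset I}) (E : I -> set Omega),
    (forall j, j \in J -> F j (E j)) ->
    P (\bigcap_(j in [set` J]) E j) = (\prod_(j <- J) P (E j))%E.

End Probability.

Section Queries.
Context (R : realType) (V : finType) (dom : V -> finType).

Definition assignment : finType := {dffun forall v : V, dom v}.

(* An assignment x to a subset X of the variables; None marks the variables
   outside X. *)
Definition passignment : finType := {dffun forall v : V, option (dom v)}.

Definition vars (x : passignment) : {set V} := [set v | isSome (x v)].

Definition matches (x : passignment) (w : assignment) : bool :=
  [forall v, (v \in vars x) ==> (x v == Some (w v))].

(* (x, y) stands for the query (x; y). *)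
Definition query : finType := (passignment * passignment)%type.

Definition pr (f : assignment -> R) (x : passignment) : R :=
  \sum_(w | matches x w) f w.

Definition cond_pr (f : assignment -> R) (q : query) : R :=
  (\sum_(w | matches q.1 w && matches q.2 w) f w) / pr f q.2.

Definition legal (p : assignment -> R) (q : query) : bool :=
  [disjoint vars q.1 & vars q.2] && (0 < pr p q.2).

Record legal_query (p : assignment -> R) : Type :=
  LegalQuery { lq :> query; _ : legal p lq }.

HB.instance Definition _ (p : assignment -> R) := [isSub for @lq p].
HB.instance Definition _ (p : assignment -> R) :=
  [Finite of legal_query p by <:].

Definition restriction (S : {set V}) (w : assignment) :
    {dffun forall u : {u : V | u \in S}, dom (val u)} :=
  [ffun u : {u : V | u \in S} => w (val u)].

Record bayes_net := BayesNet {
  parents : V -> {set V};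
  cpt : forall v : V,
    {dffun forall u : {u : V | u \in parents v}, dom (val u)} -> dom v -> R;
  parents_acyclic :
    forall s : seq V, cycle (fun u v => u \in parents v) s -> s = [::];
  cpt_pmf : forall v c, is_pmf (cpt (v := v) c)
}.

Definition net_joint (B : bayes_net) (w : assignment) : R :=
  \prod_(v : V) @cpt B v (restriction (parents B v) w) (w v).

(* When B gives the evidence y probability 0 the conditional probability is
   undefined, and the value returned may be any number in [0, 1]. *)
Definition net_answers (B : bayes_net) (Bq : query -> R) : Prop :=
  forall q : query, 0 <= Bq q <= 1 /\
    (0 < pr (net_joint B) q.2 -> Bq q = cond_pr (net_joint B) q).

Definition err (p : assignment -> R) (sq : legal_query p -> R)
    (Bq : query -> R) : R :=
  \sum_(q : legal_query p) sq q * (Bq q - cond_pr p q) ^+ 2.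

Definition nb_matches (x : passignment) (S : seq assignment) : nat :=
  count (matches x) S.

Definition empirical (S : seq assignment) (q : query) : R :=
  (count (fun w => matches q.1 w && matches q.2 w) S)%:R
    / (nb_matches q.2 S)%:R.

Definition empirical_err (M : nat) (Q : 'I_M -> query) (S : seq assignment)
    (Bq : query -> R) : R :=
  M%:R^-1 * \sum_(i < M) (Bq (Q i) - empirical S (Q i)) ^+ 2.

Definition enough_matches (M : nat) (Q : 'I_M -> query) (m : R)
    (S : seq assignment) : Prop :=
  forall i : 'I_M, m <= (nb_matches (Q i).2 S)%:R.

(* The collection from the stream D stops after exactly n examples, i.e. the
   collected sample is mkseq D n. *)
Definition stops_at (M : nat) (Q : 'I_M -> query) (m : R)
    (D : nat -> assignment) (n : nat) : Prop :=
  enough_matches Q m (mkseq D n) /\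
  forall k : nat, (k < n)%N -> ~ enough_matches Q m (mkseq D k).

End Queries.

Section SampleSizes.
Context (R : realType).

Definition M_SQ (eps delta : R) : nat :=
  `|Num.ceil (2 / eps ^+ 2 * ln (4 / delta))|%N.

Definition M'_D (eps delta : R) : R :=
  8 / eps ^+ 2 * ln (2 * (M_SQ eps delta)%:R / delta).

End SampleSizes.

(* Main.v *)
(** The error splits as |err' - err| <= |err' - err_Q| + |err_Q - err|, where
    err_Q averages the squared errors (B - p)^2 over the sampled queries, and
    each half is kept below eps/2.  Hoeffding's inequality bounds the failure of
    the query half by delta/2.

    For one query with true answer a the examples that match the evidence are
    Bernoulli trials, but the number of them in S_D is random and correlated
    with their outcomes, so the tail bound must hold simultaneously for all sample
    sizes at least m.  This is Ville's maximal inequality for the exponential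
    martingale exp(l k - n cgf(a, l)) (k successes among n matches).  A
    deviation of (B - b)^2 from (B - a)^2 by eps/2 forces b^2 - a^2, or
    (1 - b)^2 - (1 - a)^2, to be at least eps/2 in absolute value, and
    KL(b, a) >= (b^2 - a^2)^2 then gives a failure probability of at most
    4 exp(- m eps^2 / 4) = 4 (delta / 2M)^2 per query, delta/2 in total.

    The collection stops before time T with probability tending to 1; everything
    up to time T is a computation with finite sums. *)

Require Import Defs.
From HB Require Import structures.
From mathcomp Require Import all_boot all_order all_algebra finmap.
From mathcomp Require Import all_classical all_reals all_analysis.
From mathcomp Require Import ring lra.

Set Implicit Arguments.
Unset Strict Implicit.
Unset Printing Implicit Defensive.

Import Order.TTheory GRing.Theory Num.Theory.
Import numFieldNormedType.Exports.

Local Open Scope classical_set_scope.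
Local Open Scope ring_scope.

(** * Entropy bounds and Chernoff exponents for Bernoulli variables *)

Section KullbackLeibler.
Context {R : realType}.
Implicit Types a b e l t x z : R.

Lemma le_at_valley (f df : R -> R) x z :
    0 < x < 1 -> 0 < z < 1 ->
    (forall t, 0 < t < 1 -> is_derive t (1 : R) f (df t)) ->
    (forall t, 0 < t < 1 -> 0 <= df t * (t - z)) ->
  f z <= f x.
Proof.
move=> /andP[x0 x1] /andP[z0 z1] fdf df_sign.
have cf u v : 0 < u -> v < 1 -> {within `[u, v], continuous f}.
  move=> u0 v1; apply: derivable_within_continuous => t.
  rewrite in_itv/= => /andP[ut tv].
  have t01 : 0 < t < 1 by rewrite (lt_le_trans u0 ut) (le_lt_trans tv v1).
  by have [] := fdf t t01.
have dfo u v t : 0 < u -> v < 1 -> t \in `]u, v[ -> is_derive t (1 : R) f (df t).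
  move=> u0 v1; rewrite in_itv/= => /andP[ut tv]; apply: fdf.
  by rewrite (lt_trans u0 ut) (lt_trans tv v1).
have [zx|xz|->//] := ltgtP z x.
- have [c] := MVT zx (fun t => @dfo z x t z0 x1) (cf z x z0 x1).
  rewrite in_itv/= => /andP[zc cx] eqf.
  have c01 : 0 < c < 1 by rewrite (lt_trans z0 zc) (lt_trans cx x1).
  have dc : 0 <= df c.
    by have := df_sign c c01; rewrite pmulr_lge0// subr_gt0.
  by rewrite -subr_ge0 eqf mulr_ge0// subr_ge0 ltW.
- have [c] := MVT xz (fun t => @dfo x z t x0 z1) (cf x z x0 z1).
  rewrite in_itv/= => /andP[xc cz] eqf.
  have c01 : 0 < c < 1 by rewrite (lt_trans x0 xc) (lt_trans cz z1).
  have dc : df c <= 0.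
    by have := df_sign c c01; rewrite nmulr_lge0// subr_lt0.
  by rewrite -subr_le0 eqf mulr_le0_ge0// subr_ge0 ltW.
Qed.

(** Up to the entropy terms of [z], constant in [t], the function is [kl z t - G t]. *)
Lemma is_derive_kl (G g : R -> R) z t : 0 < t < 1 ->
  is_derive t (1 : R) G (g t) ->
  is_derive t (1 : R) (fun t => - (z * ln t) - (1 - z) * ln (1 - t) - G t)
    (- (z / t) + (1 - z) / (1 - t) - g t).
Proof.
move=> /andP[t0 t1] dG.
have t1' : 0 < 1 - t by rewrite subr_gt0.
have d1 := is_derive1_ln t0.
have d2 := is_derive1_ln t1'.
have d3 : is_derive t (1 : R) (fun t : R => 1 - t) (-1).
  have d := is_deriveB (is_derive_cst (1 : R) t (1 : R)) (is_derive_id t (1 : R)).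
  by apply: (is_derive_eq d); rewrite sub0r.
have d4 : is_derive t (1 : R) (fun t => ln (1 - t)) ((1 - t)^-1 * (-1)).
  exact: (@is_derive1_comp R (@ln R) (fun t => 1 - t)).
have d5 : is_derive t (1 : R) (fun t => z * ln t) (z * t^-1).
  exact: (is_deriveZ z d1).
have d6 : is_derive t (1 : R) (fun t => (1 - z) * ln (1 - t))
    ((1 - z) * ((1 - t)^-1 * (-1))).
  exact: (is_deriveZ (1 - z) d4).
have d7 := is_deriveB (is_deriveB (is_deriveN d5) d6) dG.
apply: (is_derive_eq d7); lra.
Qed.

(** Relative entropy of Bernoulli(z) with respect to Bernoulli(a). *)
Definition kl z a := z * (ln z - ln a) + (1 - z) * (ln (1 - z) - ln (1 - a)).

(** The derivative of [kl z t] in [t] is (t - z) / (t (1 - t)), so the bound on [h] gives that of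
    [kl z t - G t] the sign of t - z. The minimum is at t = z, where both terms vanish. *)
Lemma kl_ge (G g h : R -> R) z a : 0 < z < 1 -> 0 < a < 1 -> G z = 0 ->
    (forall t, 0 < t < 1 -> is_derive t (1 : R) G (g t)) ->
    (forall t, 0 < t < 1 -> g t = h t * (t - z)) ->
    (forall t, 0 < t < 1 -> h t * (t * (1 - t)) <= 1) ->
  G a <= kl z a.
Proof.
move=> z01 a01 Gz dG gE hle.
pose f t := - (z * ln t) - (1 - z) * ln (1 - t) - G t.
have : f z <= f a.
  apply: (le_at_valley a01 z01 (fun t t01 => is_derive_kl z t01 (dG t t01))).
  move=> t t01; rewrite gE//; case/andP: (t01) => t0 t1.
  have t1' : 0 < 1 - t by rewrite subr_gt0.
  have -> : (- (z / t) + (1 - z) / (1 - t) - h t * (t - z)) * (t - z)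
      = (1 - h t * (t * (1 - t))) * (t - z) ^+ 2 / (t * (1 - t)).
    by field; rewrite !gt_eqF.
  apply: divr_ge0; first by rewrite mulr_ge0 ?sqr_ge0// subr_ge0 hle.
  by rewrite mulr_ge0// ltW.
by rewrite /f /kl /= Gz; lra.
Qed.

Lemma pinsker z a : 0 < z < 1 -> 0 < a < 1 -> 2 * (z - a) ^+ 2 <= kl z a.
Proof.
move=> z01 a01.
apply: (@kl_ge (fun t => 2 * (z - t) ^+ 2) (fun t => 4 * (t - z)) (fun=> 4)) => //.
- by rewrite subrr expr0n mulr0.
- move=> t _.
  have d1 : is_derive t (1 : R) (fun t => z - t) (-1).
    have d := is_deriveB (is_derive_cst z t (1 : R)) (is_derive_id t (1 : R)).
    by apply: (is_derive_eq d); rewrite sub0r.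
  have d2 := is_deriveX 2 d1.
  have d3 := is_deriveZ 2 d2.
  by apply: (is_derive_eq d3); rewrite /GRing.scale/=; ring.
- by move=> t _; have := sqr_ge0 (1 - 2 * t); rewrite expr2; lra.
Qed.

(** After z is replaced by 1, the condition on [h] reads 4 t^2 (1 - t^2) <= 1, that is (2 t^2 - 1)^2
    >= 0. *)
Lemma kl_ge_sqr z a : 0 < z < 1 -> 0 < a < 1 ->
  (z ^+ 2 - a ^+ 2) ^+ 2 <= kl z a.
Proof.
move=> z01 a01.
apply: (@kl_ge (fun t => (z ^+ 2 - t ^+ 2) ^+ 2)
  (fun t => 4 * t * (t + z) * (t - z)) (fun t => 4 * t * (t + z))) => //.
- by rewrite subrr expr0n.
- move=> t _.
  have d0 := is_deriveX 2 (is_derive_id t (1 : R)).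
  have d1 : is_derive t (1 : R) (fun t => z ^+ 2 - t ^+ 2)  (- (2 * t)).
    have d := is_deriveB (is_derive_cst (z ^+ 2) t (1 : R)) d0.
    by apply: (is_derive_eq d); rewrite /GRing.scale/=; ring.
  have d2 := is_deriveX 2 d1.
  by apply: (is_derive_eq d2); rewrite /GRing.scale/=; ring.
- move=> t /andP[t0 t1]; case/andP: z01 => z0 z1.
  have h1 : 4 * t * (t + z) * (t * (1 - t)) <= 4 * t * (t + 1) * (t * (1 - t)).
    by rewrite ler_wpM2r ?mulr_ge0 ?ler_wpM2l ?mulr_ge0//; lra.
  have := sqr_ge0 (2 * t ^+ 2 - 1); nra.
Qed.

Definition logit z := ln z - ln (1 - z).

(** Cumulant generating function of Bernoulli(a). *)
Definition cgf a l := ln (1 - a + a * expR l).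

Lemma mgf_gt0 a l : 0 <= a <= 1 -> 0 < 1 - a + a * expR l.
Proof.
move=> /andP[a0 a1]; have el := expR_gt0 l.
have [->|an0] := eqVneq a 0; first by rewrite mul0r subr0 addr0.
by rewrite ltr_wpDl ?subr_ge0// mulr_gt0// lt0r an0.
Qed.

Lemma expR_cgf a l : 0 <= a <= 1 -> expR (cgf a l) = 1 - a + a * expR l.
Proof. by move=> a01; rewrite lnK// posrE mgf_gt0. Qed.

(** Legendre duality: tilting Bernoulli(a) by [logit z - logit a] yields Bernoulli(z), and there l z
    - cgf a l attains [kl z a]. *)
Lemma cgf_logit z a : 0 < z < 1 -> 0 < a < 1 ->
  cgf a (logit z - logit a) = (logit z - logit a) * z - kl z a.
Proof.
move=> /andP[z0 z1] /andP[a0 a1].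
have z1' : 0 < 1 - z by rewrite subr_gt0.
have a1' : 0 < 1 - a by rewrite subr_gt0.
rewrite /cgf /logit expRB !expRB !lnK//.
have -> : 1 - a + a * (z / (1 - z) / (a / (1 - a))) = (1 - a) / (1 - z).
  by field; rewrite !gt_eqF.
by rewrite ln_div// /kl; ring.
Qed.

Lemma logit_onto a l : 0 < a < 1 ->
  exists2 z, 0 < z < 1 & l = logit z - logit a.
Proof.
move=> /andP[a0 a1].
have a1' : 0 < 1 - a by rewrite subr_gt0.
have el := expR_gt0 l.
have ael : 0 < a * expR l by rewrite mulr_gt0.
have s0 : 0 < 1 - a + a * expR l by rewrite addr_gt0.
(* The mean of Bernoulli(a) tilted by [l]. *)
exists (a * expR l / (1 - a + a * expR l)).
  by rewrite divr_gt0//= ltr_pdivrMr// mul1r; lra.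
rewrite /logit.
have -> : 1 - a * expR l / (1 - a + a * expR l) = (1 - a) / (1 - a + a * expR l).
  by field; rewrite gt_eqF.
rewrite !ln_div ?posrE// lnM ?posrE// expRK; ring.
Qed.

(** With k the tilt leading to mean z, duality and Pinsker give cgf <= k z - 2 (z - a)^2, and k (z -
    a) - 2 (z - a)^2 <= k^2 / 8 by completing the square. *)
Lemma hoeffding_cgf a l : 0 <= a <= 1 -> cgf a l <= a * l + l ^+ 2 / 8.
Proof.
move=> /andP[a0 a1]; have l2 := sqr_ge0 l.
have [->|an0] := eqVneq a 0.
  by rewrite /cgf !mul0r subr0 addr0 ln1 add0r divr_ge0.
have [->|an1] := eqVneq a 1.
  by rewrite /cgf !mul1r subrr add0r expRK lerDl divr_ge0.
have a01 : 0 < a < 1 by rewrite !lt_def an0 a0 a1 eq_sym an1.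
have [z z01 ->] := logit_onto l a01.
have := pinsker z01 a01.
rewrite cgf_logit//; move: (logit z - logit a) => k.
have := sqr_ge0 (k - 4 * (z - a)); rewrite !expr2; lra.
Qed.

Lemma chernoff_sqr_gt a e : 0 <= a <= 1 -> 0 < e ->
  exists l, forall b, 0 <= b <= 1 -> a ^+ 2 + e <= b ^+ 2 ->
    e ^+ 2 <= l * b - cgf a l.
Proof.
move=> /andP[a0 a1] e0.
pose X := Num.sqrt (a ^+ 2 + e).
have X2 : X ^+ 2 = a ^+ 2 + e by rewrite sqr_sqrtr// addr_ge0// ?sqr_ge0 ?ltW.
have X0 : 0 <= X by rewrite sqrtr_ge0.
(* The slope at z = X of the lower bound (z^2 - a^2)^2 for [kl z a]. The exact tilt
   [logit X - logit a] would break down at X = 1. *)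
exists (4 * X * e) => b /andP[b0 b1] hb.
have Xb : X <= b by rewrite -(ler_pXn2r (ltn0Sn 1)) ?nnegrE// X2.
have lb : 4 * X * e * X <= 4 * X * e * b.
  by rewrite ler_wpM2l// !mulr_ge0// ltW.
suff : cgf a (4 * X * e) <= 4 * X * e * X - e ^+ 2 by lra.
have [->|an0] := eqVneq a 0.
  rewrite /cgf !mul0r subr0 addr0 ln1.
  have : 0 <= a ^+ 2 * e by rewrite mulr_ge0// ?sqr_ge0 ?ltW.
  have := sqr_ge0 e; have : 4 * X * e * X = 4 * X ^+ 2 * e by ring.
  rewrite X2 expr2; nra.
have a01 : 0 < a < 1.
  rewrite lt_def an0 a0/= lt_neqAle a1 andbT; apply/eqP => a1'.
  have : b ^+ 2 <= 1 by rewrite expr_le1.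
  by move: hb; rewrite a1' expr1n; lra.
have [z z01 El] := logit_onto (4 * X * e) a01.
rewrite {1}El cgf_logit// -El.
have klz := kl_ge_sqr z01 a01.
have z0 : 0 < z by case/andP: z01.
have eE : e = X ^+ 2 - a ^+ 2 by rewrite X2; ring.
(* It remains to see that (z^2 - a^2)^2 lies above its tangent at X. *)
suff : 0 <= 4 * X * e * (X - z) - (e ^+ 2 - (z ^+ 2 - a ^+ 2) ^+ 2) by lra.
have -> : 4 * X * e * (X - z) - (e ^+ 2 - (z ^+ 2 - a ^+ 2) ^+ 2) =
    (X - z) ^+ 2 * (X + z) * (X + z) + 2 * e * (X - z) ^+ 2.
  rewrite eE; ring.
have Xz : 0 <= X + z by rewrite addr_ge0// ltW.
have e0' : 0 <= 2 * e by lra.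
apply: addr_ge0.
  by apply: mulr_ge0 => //; apply: mulr_ge0 => //; exact: sqr_ge0.
by apply: mulr_ge0 => //; exact: sqr_ge0.
Qed.

(** The threshold [X] is now below [a], so the exact tilt [logit X - logit a] serves, except at the
    boundary cases X = 0 and a = 1. A tilt l <= 0 makes b = X the worst case. *)
Lemma chernoff_sqr_lt a e : 0 <= a <= 1 -> 0 < e ->
  exists l, forall b, 0 <= b <= 1 -> b ^+ 2 + e <= a ^+ 2 ->
    e ^+ 2 <= l * b - cgf a l.
Proof.
move=> /andP[a0 a1] e0.
have [ea|ae] := leP e (a ^+ 2); last first.
  exists 0 => b _; have := sqr_ge0 b; lra.
pose X := Num.sqrt (a ^+ 2 - e).
have X2 : X ^+ 2 = a ^+ 2 - e by rewrite sqr_sqrtr// subr_ge0.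
have X0 : 0 <= X by rewrite sqrtr_ge0.
have bX b : 0 <= b -> b ^+ 2 + e <= a ^+ 2 -> b <= X.
  by move=> b0 hb; rewrite -(ler_pXn2r (ltn0Sn 1)) ?nnegrE// X2; lra.
have eE : e = a ^+ 2 - X ^+ 2 by rewrite X2; ring.
have Xa : X < a.
  by rewrite -(ltr_pXn2r (ltn0Sn 1)) ?nnegrE// X2; lra.
suff [l l0 hl] : exists2 l, l <= 0 & e ^+ 2 <= l * X - cgf a l.
  exists l => b /andP[b0 _] /(bX _ b0) hb; apply: (le_trans hl).
  by rewrite lerD2r ler_wnM2l.
have [Xeq0|Xn0] := eqVneq X 0.
  (* The minimiser of Hoeffding's bound a l + l^2 / 8; here e = a^2. *)
  exists (- 4 * a); first by lra.
  have := @hoeffding_cgf a (- 4 * a); rewrite a0 a1 => /(_ isT).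
  rewrite Xeq0 eE Xeq0 expr0n/= subr0 -exprM.
  have : a ^+ 4 <= a ^+ 2.
    by rewrite (_ : 4 = 2 + 2)%N// exprD ler_piMr ?sqr_ge0// expr_le1.
  rewrite (_ : (2 * 2)%N = 4%N)//.
  have -> : a * (- 4 * a) + (- 4 * a) ^+ 2 / 8 = - 2 * a ^+ 2 by field.
  have := sqr_ge0 a; lra.
have [aeq1|an1] := eqVneq a 1.
  exists (- 4); first by lra.
  rewrite /cgf eE aeq1 subrr add0r mul1r expRK expr1n.
  have X1 : 0 <= 1 - X by rewrite -aeq1; lra.
  have : (1 - X) * (1 + X) ^+ 2 <= 4 by rewrite expr2; nra.
  move=> /(ler_wpM2l X1); rewrite !expr2; lra.
have a01 : 0 < a < 1 by rewrite (le_lt_trans X0 Xa) lt_neqAle an1.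
have X01 : 0 < X < 1 by rewrite lt_def Xn0 X0 (lt_le_trans Xa).
exists (logit X - logit a).
  have [X0' X1'] := andP X01; have [a0' a1'] := andP a01.
  have h1 : ln X <= ln a by rewrite ler_ln ?posrE// ltW.
  have h2 : ln (1 - a) <= ln (1 - X) by rewrite ler_ln ?posrE//; lra.
  by rewrite /logit; lra.
rewrite cgf_logit//; have := kl_ge_sqr X01 a01.
have -> : (X ^+ 2 - a ^+ 2) ^+ 2 = e ^+ 2 by rewrite eE; ring.
by lra.
Qed.

(** The difference of squares is affine in [B], so it lies between its values b^2 - a^2 at B = 0 and
    (1 - b)^2 - (1 - a)^2 at B = 1. *)
Lemma sqr_dist_cases (B : R) a b e : 0 <= B <= 1 -> 0 <= a <= 1 -> 0 <= b <= 1 ->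
    e <= `|(B - b) ^+ 2 - (B - a) ^+ 2| ->
  [\/ a ^+ 2 + e <= b ^+ 2, b ^+ 2 + e <= a ^+ 2,
      (1 - a) ^+ 2 + e <= (1 - b) ^+ 2 | (1 - b) ^+ 2 + e <= (1 - a) ^+ 2].
Proof.
move=> /andP[B0 B1] /andP[a0 a1] /andP[b0 b1].
rewrite ler_normr => /orP[] he; have [ab|/ltW ba] := leP a b.
- have : 0 <= B * (b - a) by rewrite mulr_ge0// subr_ge0.
  by move=> h; apply: Or41; lra.
- have : 0 <= (1 - B) * (a - b) by rewrite mulr_ge0// subr_ge0.
  by move=> h; apply: Or43; lra.
- have : 0 <= (1 - B) * (b - a) by rewrite mulr_ge0// subr_ge0.
  by move=> h; apply: Or44; lra.
- have : 0 <= B * (a - b) by rewrite mulr_ge0// subr_ge0.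
  by move=> h; apply: Or42; lra.
Qed.

Lemma cgf_onem a l : 0 <= a <= 1 -> cgf (1 - a) l = l + cgf a (- l).
Proof.
move=> a01; apply: expR_inj; rewrite expRD !expR_cgf//.
  by rewrite expRN; field; rewrite gt_eqF// expR_gt0.
by case/andP: a01 => a0 a1; rewrite subr_ge0 a1 gerBl.
Qed.

(* The rate is [e ^+ 2] where Pinsker's inequality would only give
   [e ^+ 2 / 2], since [(B - _) ^+ 2] is 2-Lipschitz: without this gain the two
   halves of the failure probability add up to more than [delta]. *)
Lemma chernoff_sqr_dist a e (B : R) : 0 <= a <= 1 -> 0 <= B <= 1 -> 0 < e ->
  exists ls : 'I_4 -> R, forall b, 0 <= b <= 1 ->
    e <= `|(B - b) ^+ 2 - (B - a) ^+ 2| ->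
    exists i, e ^+ 2 <= ls i * b - cgf a (ls i).
Proof.
move=> a01 B01 e0.
have onem01 (c : R) : 0 <= c <= 1 -> 0 <= 1 - c <= 1.
  by move=> /andP[c0 c1]; rewrite subr_ge0 c1 gerBl.
have [l1 h1] := chernoff_sqr_gt a01 e0.
have [l2 h2] := chernoff_sqr_lt a01 e0.
have [l3 h3] := chernoff_sqr_gt (onem01 _ a01) e0.
have [l4 h4] := chernoff_sqr_lt (onem01 _ a01) e0.
(* The last two tilts come from the complementary variable of mean 1 - a; by [cgf_onem], returning
   to [a] flips their sign. *)
exists (fun i => tnth [tuple l1; l2; - l3; - l4] i) => b b01.
case/(sqr_dist_cases B01 a01 b01) => hb.
- by exists (inord 0); rewrite (tnth_nth 0) inordK//; exact: h1.
- by exists (inord 1); rewrite (tnth_nth 0) inordK//; exact: h2.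
- exists (inord 2); rewrite (tnth_nth 0) inordK//=.
  by have := h3 _ (onem01 _ b01) hb; rewrite cgf_onem//; lra.
- exists (inord 3); rewrite (tnth_nth 0) inordK//=.
  by have := h4 _ (onem01 _ b01) hb; rewrite cgf_onem//; lra.
Qed.

End KullbackLeibler.

(** * Independent draws as finite sums: Markov, Ville and Hoeffding inequalities *)

Section ProductMass.
Context {R : realType} {W : finType} (p : W -> R).
Hypothesis p_pmf : is_pmf p.

Definition mass (s : seq W) : R := \prod_(w <- s) p w.

Lemma mass_ge0 s : 0 <= mass s.
Proof. by apply: prodr_ge0 => w _; case: p_pmf. Qed.

Lemma sum_tuple_cons T (F : seq W -> R) :
  \sum_(s : T.+1.-tuple W) F s = \sum_w \sum_(s : T.-tuple W) F (w :: s).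
Proof.
rewrite pair_bigA/= (reindex (fun u : W * T.-tuple W => [tuple of u.1 :: u.2]))//=.
exists (fun s : T.+1.-tuple W => (thead s, [tuple of behead s])) => [[w s]|s] _ /=.
  by rewrite theadE; congr (_, _); apply: val_inj.
by rewrite [RHS]tuple_eta; apply: val_inj.
Qed.

Lemma sum_mass_prod T (phi : W -> R) :
  \sum_(s : T.-tuple W) mass s * \prod_(w <- s) phi w =
  (\sum_w p w * phi w) ^+ T.
Proof.
elim: T => [|T IH].
  rewrite expr0 (big_pred1 [tuple]); last by move=> s; apply/esym/eqP; exact: tuple0.
  by rewrite /mass !big_nil mulr1.
rewrite (sum_tuple_cons _ (fun s => mass s * \prod_(w <- s) phi w)) exprS mulr_suml.
apply: eq_bigr => w _; rewrite -IH mulr_sumr; apply: eq_bigr => s _.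
by rewrite /mass !big_cons; ring.
Qed.

Lemma sum_mass T : \sum_(s : T.-tuple W) mass s = 1.
Proof.
have := sum_mass_prod T (fun=> 1); under eq_bigr do rewrite big1// mulr1.
by under [X in _ = X ^+ _ -> _]eq_bigr do rewrite mulr1; rewrite p_pmf.2 expr1n.
Qed.

Lemma mass_markov T (phi : W -> R) (c : R) (E : pred (T.-tuple W)) :
    0 < c -> (forall w, 0 <= phi w) ->
    (forall s : T.-tuple W, E s -> c <= \prod_(w <- s) phi w) ->
  \sum_(s | E s) mass s <= c^-1 * (\sum_w p w * phi w) ^+ T.
Proof.
move=> c0 phi0 hE; rewrite -sum_mass_prod mulr_sumr big_mkcond/=.
apply: ler_sum => s _; case: ifPn => [/hE Es|_].
  by rewrite mulrCA ler_peMr ?mass_ge0// mulrC ler_pdivlMr// mul1r.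
by rewrite !mulr_ge0 ?invr_ge0 ?mass_ge0 ?prodr_ge0// ltW.
Qed.

Lemma mass_le1 T (E : pred (T.-tuple W)) : \sum_(s | E s) mass s <= 1.
Proof.
rewrite -(sum_mass T) big_mkcond; apply: ler_sum => s _.
by case: ifP => // _; exact: mass_ge0.
Qed.

Lemma mass_union (I : finType) T (E : pred (T.-tuple W))
    (F : I -> pred (T.-tuple W)) :
    (forall s, E s -> exists i, F i s) ->
  \sum_(s | E s) mass s <= \sum_i \sum_(s | F i s) mass s.
Proof.
move=> EF; under [leRHS]eq_bigr do rewrite big_mkcond.
rewrite exchange_big big_mkcond/=; apply: ler_sum => s _.
case: ifPn => [/EF[i Fis]|_].
  rewrite (bigD1 i)//= Fis lerDl sumr_ge0// => j _.
  by case: ifP => // _; exact: mass_ge0.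
by rewrite sumr_ge0// => j _; case: ifP => // _; exact: mass_ge0.
Qed.

(* Ville's inequality for the supermartingale of the partial products. *)
Lemma mass_maximal T (phi : W -> R) (c : R) :
    0 < c -> (forall w, 0 < phi w) -> \sum_w p w * phi w <= 1 ->
  \sum_(s : T.-tuple W |
      [exists n : 'I_T.+1, c <= \prod_(w <- take n s) phi w]) mass s <= c^-1.
Proof.
move=> c0 phi0 phi1; elim: T c c0 => [|T IH] c c0; have [c1|c1] := leP c 1.
- by rewrite (le_trans (mass_le1 _))// -invr1 lef_pV2 ?posrE.
- rewrite big_pred0 ?invr_ge0 ?ltW// => s; apply/existsP => -[n].
  by rewrite (tuple0 s)/= big_nil leNgt c1.
- by rewrite (le_trans (mass_le1 _))// -invr1 lef_pV2 ?posrE.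
- rewrite big_mkcond (sum_tuple_cons _ (fun s => if [exists n : 'I_T.+2,
    c <= \prod_(w <- take n s) phi w] then mass s else 0)).
  (* After a first draw w the remaining product has to reach c / phi w, which the induction
     hypothesis bounds by phi w / c. The empty prefix cannot reach c > 1. *)
  apply: (@le_trans _ _ (\sum_w p w * (phi w / c))); last first.
    under eq_bigr do rewrite mulrA.
    by rewrite -mulr_suml ler_piMl// invr_ge0 ltW.
  apply: ler_sum => w _.
  apply: (@le_trans _ _ (p w * \sum_(s : T.-tuple W |
      [exists n : 'I_T.+1, c / phi w <= \prod_(w <- take n s) phi w]) mass s)).
    rewrite big_distrr/= [leRHS]big_mkcond; apply: ler_sum => s _.
    case: ifPn => [/existsP[[n nT]/= hn]|_]; last first.
      by case: ifP => // _; rewrite mulr_ge0 ?mass_ge0//; case: p_pmf.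
    rewrite ifT; first by rewrite /mass big_cons.
    case: n nT hn => [|n] nT; first by rewrite big_nil leNgt c1.
    rewrite big_cons => hn; apply/existsP; exists (Ordinal (nT : n < T.+1)%N).
    by rewrite ler_pdivrMr// mulrC.
  apply: ler_wpM2l; first by case: p_pmf.
  by rewrite (le_trans (IH _ _))// ?divr_gt0// invf_div.
Qed.

Lemma expR_chord (l y : R) : 0 <= y <= 1 -> expR (l * y) <= 1 - y + y * expR l.
Proof.
move=> y01.
have := convex_expR (Itv01 (andP y01).1 (andP y01).2) l 0.
rewrite !convRE/= !mulr0 !addr0 expR0 mulr1 mulrC [X in _ <= X -> _]addrC.
exact.
Qed.

Section Hoeffding.
Variable f : W -> R.
Hypothesis f01 : forall w, 0 <= f w <= 1.
Let mean : R := \sum_w p w * f w.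

Lemma mean01 : 0 <= mean <= 1.
Proof.
have [p0 p1] := p_pmf; apply/andP; split.
  by apply: sumr_ge0 => w _; rewrite mulr_ge0//; case/andP: (f01 w).
rewrite -p1; apply: ler_sum => w _; rewrite ler_piMr//.
by case/andP: (f01 w).
Qed.

(** By convexity of the exponential, the moment generating function of [f] is at most that of a
    Bernoulli variable with the same mean. *)
Lemma hoeffding_mgf l :
  \sum_w p w * expR (l * (f w - mean)) <= expR (l ^+ 2 / 8).
Proof.
have [p0 p1] := p_pmf.
have h : \sum_w p w * expR (l * f w) <= expR (mean * l + l ^+ 2 / 8).
  apply: (@le_trans _ _ (expR (cgf mean l))); last first.
    by rewrite ler_expR hoeffding_cgf// mean01.
  rewrite expR_cgf ?mean01//.
  apply: (@le_trans _ _ (\sum_w p w * (1 - f w + f w * expR l))).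
    by apply: ler_sum => w _; rewrite ler_wpM2l// expR_chord.
  under eq_bigr do rewrite mulrDr mulrBr mulr1 mulrA.
  by rewrite big_split/= sumrB p1 -mulr_suml.
under eq_bigr do rewrite mulrBr expRB mulrA.
by rewrite -mulr_suml ler_pdivrMr ?expR_gt0// -expRD addrC mulrC.
Qed.

(** Chernoff's method; the sign of [l] selects the tail. *)
Lemma hoeffding_tail M e (E : pred (M.-tuple W)) l :
    (forall s : M.-tuple W, E s -> M%:R * e <= l * \sum_(w <- s) (f w - mean)) ->
  \sum_(s | E s) mass s <= expR (M%:R * (l ^+ 2 / 8 - e)).
Proof.
move=> hE.
have := @mass_markov M (fun w => expR (l * (f w - mean))) (expR (M%:R * e)) E.
move=> /(_ (expR_gt0 _) (fun=> expR_ge0 _)) h.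
apply: (le_trans (h _)) => [s /hE Es|].
  by rewrite -expR_sum ler_expR -mulr_sumr.
rewrite mulrBr expRB mulrC ler_pdivrMr ?expR_gt0// divfK ?gt_eqF ?expR_gt0//.
rewrite expRM_natl lerXn2r// ?nnegrE ?expR_ge0 ?hoeffding_mgf//.
by apply: sumr_ge0 => w _; rewrite mulr_ge0 ?expR_ge0//; case: p_pmf.
Qed.

Lemma hoeffding M e : 0 <= e ->
  \sum_(s : M.-tuple W | M%:R * e <= `|\sum_(w <- s) (f w - mean)|) mass s <=
  2 * expR (- (M%:R * (2 * e ^+ 2))).
Proof.
move=> e0; pose F (b : bool) (s : M.-tuple W) :=
  M%:R * e <= (-1) ^+ b * \sum_(w <- s) (f w - mean).
apply: (le_trans (@mass_union bool M _ F _)) => [s|].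
  rewrite ler_normr => /orP[h|h]; [exists false|exists true]; rewrite /F.
    by rewrite expr0 mul1r.
  by rewrite expr1 mulN1r.
suff h b : \sum_(s : M.-tuple W | F b s) mass s <= expR (- (M%:R * (2 * e ^+ 2))).
  by rewrite big_bool mulr_natl mulr2n lerD.
(* The tilt of absolute value 4 e minimises l^2 / 8 - |l| e. *)
have -> : - (M%:R * (2 * e ^+ 2)) =
    M%:R * ((4 * e * (-1) ^+ b) ^+ 2 / 8 - 4 * e ^+ 2).
  by rewrite exprMn sqrr_sign; field.
apply: hoeffding_tail => s; rewrite /F.
have e4 : 0 <= 4 * e by rewrite mulr_ge0.
rewrite -(mulrA (4 * e)) (_ : _ * (4 * e ^+ 2) = 4 * e * (M%:R * e)); last by ring.
exact: ler_wpM2l.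
Qed.
End Hoeffding.

End ProductMass.

(** * Deviation of the empirical answers, uniformly over prefixes of the examples *)

Section DataPhase.
Context {R : realType} {V : finType} {dom : V -> finType}.
Context (p : assignment dom -> R) (p_pmf : is_pmf p).
Implicit Types (q : query dom) (s : seq (assignment dom)).

Lemma cond_pr01 q : 0 < pr p q.2 -> 0 <= cond_pr p q <= 1.
Proof.
have [p0 _] := p_pmf => q0.
rewrite /cond_pr divr_ge0 ?(ltW q0) ?sumr_ge0//= ler_pdivrMr// mul1r /pr.
rewrite [leLHS]big_mkcond [leRHS]big_mkcond; apply: ler_sum => w _.
by case: (matches q.1 w) => //=; case: ifP.
Qed.

Lemma empirical01 s q : (0 < nb_matches q.2 s)%N -> 0 <= empirical R s q <= 1.
Proof.
move=> s0; rewrite /empirical divr_ge0//= ler_pdivrMr ?ltr0n// mul1r ler_nat.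
by apply: sub_count => w /andP[].
Qed.

(** One factor of the exponential martingale: the density of the law in which, given the evidence,
    the answer is tilted by [l]. Examples that miss the evidence leave the product unchanged. *)
Definition likelihood_ratio q (l : R) (w : assignment dom) : R :=
  if matches q.2 w then expR (l * (matches q.1 w)%:R - cgf (cond_pr p q) l)
  else 1.

Lemma likelihood_ratio_mean q l : 0 < pr p q.2 ->
  \sum_w p w * likelihood_ratio q l w = 1.
Proof.
move=> q0; have a01 := cond_pr01 q0; set a := cond_pr p q in a01 *.
set E := expR (cgf a l); have E0 : 0 < E by rewrite expR_gt0.
(* The ratio is affine in the indicators of the evidence and of evidence with answer, whose masses
   are pr and a pr. *)
transitivity (\sum_w (p w + (if matches q.2 w then p w else 0) * (E^-1 - 1) +
    (if matches q.1 w && matches q.2 w then p w else 0) * ((expR l - 1) / E))).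
  apply: eq_bigr => w _; rewrite /likelihood_ratio.
  case: (matches q.2 w); case: (matches q.1 w) => /=;
    rewrite ?mulr1 ?mulr0 ?expRB ?expR0 -/a -/E; field; exact/lt0r_neq0.
rewrite !big_split/= -!mulr_suml -!big_mkcond/= p_pmf.2.
have -> : \sum_(w | matches q.1 w && matches q.2 w) p w = a * pr p q.2.
  by rewrite /a /cond_pr divfK// gt_eqF.
rewrite -/(pr p q.2).
have : E = 1 - a + a * expR l by exact: expR_cgf.
move=> EE; apply/eqP; rewrite -subr_eq0; apply/eqP.
transitivity (pr p q.2 * (1 - a + a * expR l - E) / E).
  by field; exact/lt0r_neq0.
by rewrite -EE subrr mulr0 mul0r.
Qed.

Lemma prod_likelihood_ratio q l s :
  \prod_(w <- s) likelihood_ratio q l w =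
  expR (l * (count (fun w => matches q.1 w && matches q.2 w) s)%:R -
        cgf (cond_pr p q) l * (nb_matches q.2 s)%:R).
Proof.
elim: s => [|w s IH]; first by rewrite big_nil !mulr0 subr0 expR0.
rewrite big_cons IH /likelihood_ratio /nb_matches/=.
case: (matches q.2 w); rewrite ?andbT ?andbF/= ?add0n ?mul1r//.
by rewrite -expRD !natrD; congr expR; ring.
Qed.

(** The quantifier over [n] covers whatever prefix the collection stops at. At an offending prefix
    one of the four tilts pushes the product of ratios to at least [expR (m * e ^+ 2)];
    [mass_maximal] bounds this for all [n] at once. *)
Lemma data_deviation T q (B m e : R) :
    0 < pr p q.2 -> 0 <= B <= 1 -> 0 < m -> 0 < e ->
  \sum_(s : T.-tuple (assignment dom) | [exists n : 'I_T.+1,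
      (m <= (nb_matches q.2 (take n s))%:R) &&
      (e <= `|(B - empirical R (take n s) q) ^+ 2 - (B - cond_pr p q) ^+ 2|)])
    mass p s <= 4 * expR (- (m * e ^+ 2)).
Proof.
move=> q0 B01 m0 e0; have a01 := cond_pr01 q0.
have [ls hls] := chernoff_sqr_dist a01 B01 e0.
pose F (i : 'I_4) (s : T.-tuple (assignment dom)) := [exists n : 'I_T.+1,
  expR (m * e ^+ 2) <= \prod_(w <- take n s) likelihood_ratio q (ls i) w].
apply: (le_trans (@mass_union _ _ _ p_pmf _ T _ F _)) => [s|].
  move=> /existsP[n /andP[hm he]].
  have nb0 : (0 < nb_matches q.2 (take n s))%N.
    by rewrite -(ltr0n R) (lt_le_trans m0 hm).
  have [i hi] := hls _ (empirical01 nb0) he.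
  exists i; apply/existsP; exists n; rewrite prod_likelihood_ratio ler_expR.
  have -> : (count (fun w => matches q.1 w && matches q.2 w) (take n s))%:R =
      empirical R (take n s) q * (nb_matches q.2 (take n s))%:R.
    by rewrite /empirical divfK// pnatr_eq0 -lt0n.
  rewrite mulrA -mulrBl [leRHS]mulrC.
  by apply: ler_pM => //; [exact: ltW|exact: sqr_ge0].
suff h i : \sum_(s : T.-tuple (assignment dom) | F i s) mass p s <=
    expR (- (m * e ^+ 2)).
  by rewrite (le_trans (ler_sum _ (fun i _ => h i)))// sumr_const card_ord
    mulr_natl.
rewrite expRN; apply: mass_maximal => //.
- exact: expR_gt0.
- by move=> w; rewrite /likelihood_ratio; case: ifP => // _; exact: expR_gt0.
- by rewrite likelihood_ratio_mean.
Qed.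

(** Markov's inequality for the exponential of minus the number of matches. The tilt -1 is not
    optimised: the bound only has to vanish as T grows. *)
Lemma few_matches T (y : passignment dom) (m : R) :
  \sum_(s : T.-tuple (assignment dom) | (nb_matches y s)%:R < m) mass p s <=
  expR (m + T%:R * cgf (pr p y) (-1)).
Proof.
have [p0 p1] := p_pmf.
have r01 : 0 <= pr p y <= 1.
  rewrite sumr_ge0//= -p1 /pr big_mkcond/=; apply: ler_sum => w _.
  by case: ifP.
pose phi w : R := if matches y w then expR (- 1) else 1.
have phi_mean : \sum_w p w * phi w = expR (cgf (pr p y) (-1)).
  rewrite expR_cgf//.
  transitivity (\sum_w (p w + (if matches y w then p w else 0) * (expR (-1) - 1))).
    by apply: eq_bigr => w _; rewrite /phi; case: ifP => _; ring.
  by rewrite big_split/= -mulr_suml -big_mkcond/= p1 /pr; ring.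
have phi_prod s : \prod_(w <- s) phi w = expR (- (nb_matches y s)%:R).
  elim: s => [|w s IH]; first by rewrite big_nil oppr0 expR0.
  rewrite big_cons IH /phi /nb_matches/=; case: (matches y w).
    by rewrite -expRD natrD opprD.
  by rewrite mul1r add0n.
rewrite expRD expRM_natl -phi_mean -[expR m]invrK -expRN.
apply: mass_markov => //; first exact: expR_gt0.
  by move=> w; rewrite /phi; case: ifP => // _; exact: expR_ge0.
by move=> s hs; rewrite phi_prod ler_expR lerN2 ltW.
Qed.

End DataPhase.

(** * From the probability space to finite sums over observed values *)

Section FinitelyManyObservations.
Context {R : realType} {d : measure_display} {Omega : measurableType d}.
Context (P : probability Omega R) {K W : finType} (M : nat).
Context (sq : K -> R) (p : W -> R).
Context (Q : 'I_M -> Omega -> K) (D : nat -> Omega -> W).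
Hypothesis hQ : forall i, has_law P (Q i) sq.
Hypothesis hD : forall t, has_law P (D t) p.
Hypothesis hQD : mutually_independent P
  (fun k : 'I_M + nat =>
    match k with inl i => sigma_of (Q i) | inr t => sigma_of (D t) end).

Lemma sigma_of_preimage (A : finType) (X : Omega -> A) (B : set A) :
  sigma_of X (X @^-1` B).
Proof. by exists B => //; rewrite setTI. Qed.

Let atom T (Qs : M.-tuple K) (s : T.-tuple W) : set Omega :=
  [set w | [tuple Q i w | i < M] = Qs /\ [tuple D t w | t < T] = s].

Let atomE T (Qs : M.-tuple K) (s : T.-tuple W) :
  measurable (atom Qs s) /\ P (atom Qs s) = (mass sq Qs * mass p s)%:E.
Proof.
(* The default [D t w] makes the condition trivially true for t >= T, so [E] is defined on the whole
   index type. *)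
pose E (k : 'I_M + nat) : set Omega :=
  match k with
  | inl i => Q i @^-1` [set tnth Qs i]
  | inr t => [set w | nth (D t w) s t = D t w]
  end.
have Einr (t : 'I_T) : E (inr (t : nat)) = D t @^-1` [set tnth s t].
  have e w : nth (D t w) s t = tnth s t by rewrite (tnth_nth (D t w)).
  by apply/seteqP; split => w /=; rewrite e => ->.
pose r : seq ('I_M + nat) :=
  [seq inl i | i <- enum 'I_M] ++ [seq inr (val t) | t <- enum 'I_T].
have r_uniq : uniq r.
  have il : injective (inl : 'I_M -> 'I_M + nat) by move=> i j [].
  have ir : injective (fun t : 'I_T => inr (val t) : 'I_M + nat).
    by move=> i j [] /val_inj.
  rewrite cat_uniq (map_inj_uniq il) (map_inj_uniq ir) !enum_uniq andbT/=.
  by apply/hasPn => k /mapP[t _ ->]; apply/mapP => -[].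
pose J := [fset k in r]%fset.
have inJ k : (k \in J) = (k \in r) by rewrite in_fset.
have atomJ : atom Qs s = \bigcap_(k in [set` J]) E k.
  apply/seteqP; split => w.
    move=> [Qw Dw] k; rewrite /= inJ mem_cat => /orP[]/mapP[i _ ->].
      by rewrite /= -Qw tnth_mktuple.
    by rewrite Einr/= -Dw tnth_mktuple.
  move=> Ew; split; apply: eq_from_tnth => i; rewrite tnth_mktuple.
    have Ji : [set` J] (inl i) by rewrite /= inJ mem_cat map_f// mem_enum.
    exact: (Ew _ Ji).
  have : E (inr (i : nat)) w.
    apply: Ew; rewrite /= inJ mem_cat; apply/orP; right.
    by apply/mapP; exists i; rewrite ?mem_enum.
  by rewrite Einr.
have JE k : k \in J -> match k with
    inl i => sigma_of (Q i) | inr t => sigma_of (D t) end (E k).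
  rewrite inJ mem_cat => /orP[]/mapP[i _ ->]; first exact: sigma_of_preimage.
  by rewrite Einr; exact: sigma_of_preimage.
have mE k : k \in J -> measurable (E k).
  by move=> /JE; case: k => [i|t]; [exact: (hQ i).1|exact: (hD t).1].
split.
  rewrite atomJ -[X in measurable X]setCK setC_bigcap; apply: measurableC.
  apply: fin_bigcup_measurable; first exact: finite_fset.
  by move=> k Jk; apply: measurableC; exact: mE.
rewrite atomJ hQD// (perm_big r); last first.
  by apply: uniq_perm; rewrite ?fset_uniq.
rewrite big_cat !big_map EFinM; congr (_ * _)%E.
  rewrite /mass big_tuple -prodEFin -enumT big_enum; apply: eq_bigr => i _.
  exact: (hQ i).2.
rewrite /mass big_tuple -prodEFin -enumT big_enum; apply: eq_bigr => i _.
by rewrite Einr (hD i).2.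
Qed.

(** The event is a finite disjoint union of atoms, each of product probability by independence. *)
Lemma prob_observations T (G : M.-tuple K -> T.-tuple W -> bool) :
  let A := [set w | G [tuple Q i w | i < M] [tuple D t w | t < T]] in
  measurable A /\
  P A = (\sum_(Qs : M.-tuple K) \sum_(s : T.-tuple W | G Qs s)
           mass sq Qs * mass p s)%:E.
Proof.
move=> A; pose F (u : M.-tuple K * T.-tuple W) := atom u.1 u.2.
pose r := enum [pred u : M.-tuple K * T.-tuple W | G u.1 u.2].
have AE : A = \bigcup_(u in [set` r]) F u.
  apply/seteqP; split => w.
    move=> Gw; exists ([tuple Q i w | i < M], [tuple D t w | t < T]) => //.
    by rewrite /= mem_enum.
  by move=> [[Qs s]]; rewrite /= mem_enum => Gu [/= eQ es]; rewrite /A/= eQ es.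
have mF u : [set` r] u -> measurable (F u).
  by move=> _; exact: (atomE u.1 u.2).1.
have fr : finite_set [set` r] by exact: finite_seq.
split; first by rewrite AE; exact: fin_bigcup_measurable.
rewrite AE measure_fin_bigcup//; last first.
  move=> [Q1 s1] [Q2 s2] _ _ [w [[/= q1 e1] [/= q2 e2]]].
  by rewrite -q1 -q2 -e1 -e2.
rewrite -fsbig_seq ?enum_uniq// big_enum/= pair_big_dep/= -sumEFin.
by apply: eq_bigr => u _; exact: (atomE u.1 u.2).2.
Qed.

End FinitelyManyObservations.

(** * The two sample sizes each cost at most delta/2 *)

Section SampleSizeBounds.
Context {R : realType} (eps delta : R).
Hypotheses (heps : 0 < eps < 1) (hdelta : 0 < delta < 1).
Let e := eps / 2.
Let M := M_SQ eps delta.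

Let eps0 : 0 < eps. Proof. by case/andP: heps. Qed.
Let delta0 : 0 < delta. Proof. by case/andP: hdelta. Qed.

(** From ln x >= 1 - 1/x, with 1/x = delta/4 < 1/4. *)
Lemma ln_4delta : 3 / 4 <= ln (4 / delta).
Proof.
have h : 0 < 4 / delta by rewrite divr_gt0.
have := expR_ge1Dx (- ln (4 / delta)).
rewrite expRN lnK ?posrE// invf_div; case/andP: hdelta; lra.
Qed.

Lemma M_SQ_ge : 2 / eps ^+ 2 * ln (4 / delta) <= M%:R.
Proof.
by apply: (le_trans (ceil_ge _)); rewrite /M /M_SQ natr_absz ler_int ler_norm.
Qed.

Lemma M_SQ_ge2 : (2 <= M)%N.
Proof.
have h : 3 / 2 <= M%:R :> R.
  apply: le_trans M_SQ_ge.
  have : 2 <= 2 / eps ^+ 2.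
    rewrite ler_pdivlMr ?exprn_gt0// ger_pMr// expr_le1//; last exact: ltW.
    by case/andP: heps => _ /ltW.
  have := ln_4delta; nra.
have : 1 < M%:R :> R by lra.
by rewrite ltr1n.
Qed.

Lemma query_budget : 2 * expR (- (M%:R * (2 * e ^+ 2))) <= delta / 2.
Proof.
have h : ln (4 / delta) <= M%:R * (2 * e ^+ 2).
  have := M_SQ_ge.
  have e2 : 0 < eps ^+ 2 / 2 by rewrite divr_gt0// exprn_gt0.
  move=> /(ler_wpM2r (ltW e2)).
  have -> : 2 / eps ^+ 2 * ln (4 / delta) * (eps ^+ 2 / 2) = ln (4 / delta).
    by field; rewrite gt_eqF.
  by move=> /le_trans; apply; rewrite /e; lra.
have : expR (- (M%:R * (2 * e ^+ 2))) <= delta / 4.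
  have -> : delta / 4 = expR (- ln (4 / delta)).
    by rewrite expRN lnK ?posrE ?divr_gt0// invf_div.
  by rewrite ler_expR lerN2.
lra.
Qed.

Lemma M'_D_gt0 : 0 < M'_D eps delta.
Proof.
rewrite /M'_D mulr_gt0 ?divr_gt0 ?exprn_gt0// ln_gt0//.
rewrite ltr_pdivlMr// mul1r.
have : 2 <= M%:R :> R by rewrite ler_nat M_SQ_ge2.
by case/andP: hdelta; rewrite /M; lra.
Qed.

(** The exponent is 2 ln(2M / delta), so the left side equals delta (delta / M), and M >= 2 with
    delta < 1 finishes. *)
Lemma data_budget :
  M%:R * (4 * expR (- (M'_D eps delta * e ^+ 2))) <= delta / 2.
Proof.
have M2 : 2 <= M%:R :> R by rewrite ler_nat M_SQ_ge2.
have x0 : 0 < 2 * M%:R / delta by rewrite divr_gt0// mulr_gt0//; lra.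
have -> : M'_D eps delta * e ^+ 2 = 2%:R * ln (2 * M%:R / delta).
  by rewrite /M'_D /e -/M; field; rewrite gt_eqF.
rewrite expRN expRM_natl lnK ?posrE//.
have -> : M%:R * (4 * ((2 * M%:R / delta) ^+ 2)^-1) = delta * (delta / M%:R).
  by field; rewrite !gt_eqF//; lra.
rewrite ler_wpM2l//; first exact: ltW.
rewrite ler_pdivrMr; last by lra.
by case/andP: hdelta; lra.
Qed.

End SampleSizeBounds.

(** * Success probability within a finite horizon T *)

Section Validation.
Context {R : realType} {V : finType} {dom : V -> finType}.
Context (p : assignment dom -> R) (p_pmf : is_pmf p).
Context (sq : legal_query p -> R) (sq_pmf : is_pmf sq).
Context (Bq : query dom -> R) (Bq01 : forall q, 0 <= Bq q <= 1).
Context (m : R) (m0 : 0 < m).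
Implicit Types q : legal_query p.

Lemma legal_query_gt0 q : 0 < pr p (lq q).2.
Proof. by case: q => q /= /andP[]. Qed.

Lemma sqr_error01 q : 0 <= (Bq q - cond_pr p q) ^+ 2 <= 1.
Proof.
have /andP[c0 c1] := cond_pr01 p_pmf (legal_query_gt0 q).
have /andP[b0 b1] := Bq01 q; rewrite sqr_ge0/=.
have : 0 <= (1 - Bq q + cond_pr p q) * (1 + Bq q - cond_pr p q).
  by rewrite mulr_ge0//; lra.
lra.
Qed.

(** Legality gives the evidence positive probability, so the cgf at -1 is negative; one T serves all
    queries because they are finitely many. *)
Lemma few_matches_vanish (eta : R) : 0 < eta ->
  exists T : nat, forall q, expR (m + T%:R * cgf (pr p (lq q).2) (-1)) <= eta.
Proof.
move=> eta0.
have tail q : exists T : nat, forall T', (T <= T')%N ->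
    expR (m + T'%:R * cgf (pr p (lq q).2) (-1)) <= eta.
  have q0 := legal_query_gt0 q; set r := pr p (lq q).2 in q0 *.
  have r1 : r <= 1.
    rewrite /r /pr big_mkcond -p_pmf.2; apply: ler_sum => w _.
    by case: ifP => // _; case: p_pmf.
  have c0 : cgf r (-1) < 0.
    have e1 : expR (- 1) < 1 :> R by rewrite expR_lt1 ltrN10.
    rewrite -expR_lt1 expR_cgf ?r1 ?ltW//; nra.
  pose T := Num.bound `|(m - ln eta) / - cgf r (-1)|.
  exists T => T' TT'.
  rewrite -[leRHS](@lnK _ eta) ?posrE// ler_expR.
  have hT : (m - ln eta) / - cgf r (-1) <= T'%:R.
    apply: (le_trans (ler_norm _)); apply: ltW.
    by apply: lt_le_trans (archi_boundP (normr_ge0 _)) _; rewrite ler_nat.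
  by move: hT; rewrite ler_pdivrMr ?oppr_gt0//; lra.
have [T0 hT0] := choice tail.
exists (\max_q T0 q) => q; apply: hT0; exact: leq_bigmax.
Qed.

(** [stops_at] and closeness of the scores, read off a finite sequence so that it can be summed over
    tuples. *)
Definition validates M (Qs : 'I_M -> legal_query p) (e : R)
    (s : seq (assignment dom)) n : Prop :=
  [/\ enough_matches (fun i => lq (Qs i)) m (take n s),
      forall k, (k < n)%N -> ~ enough_matches (fun i => lq (Qs i)) m (take k s) &
      `|empirical_err (fun i => lq (Qs i)) (take n s) Bq - err sq Bq| < e].

Section Failure.
Context (M T : nat) (Qs : M.-tuple (legal_query p)) (e : R) (e0 : 0 < e).
Hypothesis M0 : (0 < M)%N.

Definition bad_queries :=
  M%:R * e <=
  `|\sum_(q <- Qs) ((Bq q - cond_pr p q) ^+ 2 - err sq Bq)|.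

Definition bad_estimate (q : query dom) (s : T.-tuple (assignment dom)) :=
  [exists n : 'I_T.+1, (m <= (nb_matches q.2 (take n s))%:R) &&
    (e <= `|(Bq q - empirical R (take n s) q) ^+ 2 - (Bq q - cond_pr p q) ^+ 2|)].

(** If every query has its matches by time T, the collection stops at a least n <= T, and good
    queries with good estimates at n give success. *)
Lemma failure_cases (s : T.-tuple (assignment dom)) :
    ~~ bad_queries ->
    ~ (exists n : 'I_T.+1, validates (tnth Qs) (e + e) s n) ->
  exists i, bad_estimate (tnth Qs i) s \/
    (nb_matches (lq (tnth Qs i)).2 s)%:R < m.
Proof.
rewrite -ltNge => gQ nval; apply: contrapT => /forallNP nbad.
pose enough n := `[< enough_matches (fun i => lq (tnth Qs i)) m (take n s) >].
have enoughT : enough T.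
  apply/asboolP => i; rewrite take_oversize ?size_tuple//= leNgt.
  by apply/negP => few; apply: (nbad i); right.
case: (ex_minnP (ex_intro enough T enoughT)) => n /asboolP hn n_min; apply: nval.
have nT : (n < T.+1)%N by rewrite ltnS n_min.
exists (Ordinal nT); split => // [k kn /asboolP/n_min|].
  by rewrite leqNgt kn.
have Mgt0 : 0 < M%:R :> R by rewrite ltr0n.
set t := take _ s.
have close i : `|(Bq (tnth Qs i) - empirical R t (tnth Qs i)) ^+ 2 -
    (Bq (tnth Qs i) - cond_pr p (tnth Qs i)) ^+ 2| < e.
  rewrite ltNge; apply/negP => far; apply: (nbad i); left.
  by apply/existsP; exists (Ordinal nT); rewrite far andbT; exact: hn.
(* Estimation error on the sampled queries plus sampling error of the queries. *)
have -> : empirical_err (fun i => lq (tnth Qs i)) t Bq - err sq Bq = M%:R^-1 *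
    (\sum_(i < M) ((Bq (tnth Qs i) - empirical R t (tnth Qs i)) ^+ 2 -
       (Bq (tnth Qs i) - cond_pr p (tnth Qs i)) ^+ 2) +
     \sum_(q <- Qs) ((Bq q - cond_pr p q) ^+ 2 - err sq Bq)).
  rewrite big_tuple -big_split/= /empirical_err.
  under [X in _ = _ * X]eq_bigr do rewrite addrA subrK.
  rewrite sumrB sumr_const card_ord -[err sq Bq *+ M]mulr_natl mulrBr mulKf//.
  by rewrite gt_eqF.
rewrite normrM gtr0_norm ?invr_gt0// ltr_pdivrMl//.
apply: (le_lt_trans (ler_normD _ _)); rewrite mulrDr; apply: ler_ltD => //.
apply: (le_trans (ler_norm_sum _ _ _)).
rewrite -[X in _ <= X%:R * _]card_ord mulr_natl -sumr_const.
by apply: ler_sum => i _; exact: ltW.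
Qed.

Lemma failure_mass (eta : R) : 0 <= eta ->
    (forall q, expR (m + T%:R * cgf (pr p (lq q).2) (-1)) <= eta) ->
    ~~ bad_queries ->
  \sum_(s : T.-tuple (assignment dom) |
      ~~ `[< exists n : 'I_T.+1, validates (tnth Qs) (e + e) s n >]) mass p s <=
  M%:R * (4 * expR (- (m * e ^+ 2)) + eta).
Proof.
move=> eta0 hT gQ.
pose F (u : 'I_M * bool) (s : T.-tuple (assignment dom)) :=
  if u.2 then bad_estimate (tnth Qs u.1) s
  else (nb_matches (lq (tnth Qs u.1)).2 s)%:R < m.
pose X := 4 * expR (- (m * e ^+ 2)).
have FX u : \sum_(s | F u s) mass p s <= if u.2 then X else eta.
  case: u => i [] /=; first exact: data_deviation (legal_query_gt0 _) _ _ _.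
  exact: le_trans (few_matches p_pmf _ _ _) (hT _).
apply: (le_trans (@mass_union _ _ _ p_pmf _ _ _ F _)) => [s /asboolPn|].
  by move=> /(failure_cases gQ)[i [bad|few]]; [exists (i, true)|exists (i, false)].
apply: (le_trans (ler_sum _ (fun u _ => FX u))).
rewrite -(pair_bigA _ (fun (_ : 'I_M) (b : bool) => if b then X else eta))/=.
under eq_bigr do rewrite big_bool/=.
by rewrite sumr_const card_ord mulr_natl.
Qed.

End Failure.

(** Bad query samples are written off entirely; for each other fixed sample, the failing example
    sequences have mass at most [Z]. *)
Lemma validation_mass (M T : nat) (e eta : R) : 0 < e -> (0 < M)%N -> 0 <= eta ->
    (forall q, expR (m + T%:R * cgf (pr p (lq q).2) (-1)) <= eta) ->
  1 - (2 * expR (- (M%:R * (2 * e ^+ 2))) +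
       M%:R * (4 * expR (- (m * e ^+ 2)) + eta)) <=
  \sum_(Qs : M.-tuple (legal_query p))
    \sum_(s : T.-tuple (assignment dom) |
      `[< exists n : 'I_T.+1, validates (tnth Qs) (e + e) s n >])
    mass sq Qs * mass p s.
Proof.
move=> e0 M0 eta0 hT; set Z := M%:R * (_ + eta).
have Z0 : 0 <= Z by rewrite /Z mulr_ge0// addr_ge0// ?mulr_ge0 ?expR_ge0.
have tail := hoeffding sq_pmf sqr_error01 M (ltW e0).
rewrite -/(err sq Bq) in tail.
apply: (@le_trans _ _ (\sum_(Qs : M.-tuple (legal_query p))
    (mass sq Qs - (if bad_queries Qs e then mass sq Qs else 0) - mass sq Qs * Z))).
  rewrite !sumrB -big_mkcond/= -mulr_suml sum_mass// mul1r.
  by rewrite /bad_queries; lra.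
apply: ler_sum => Qs _; rewrite -mulr_sumr.
have mQ := mass_ge0 sq_pmf Qs.
case: ifPn => [_|gQ].
  rewrite subrr sub0r (@le_trans _ _ 0)//; first by rewrite oppr_le0 mulr_ge0.
  by rewrite mulr_ge0// sumr_ge0// => s _; exact: mass_ge0.
rewrite subr0 -[X in X - _]mulr1 -mulrBr ler_wpM2l//.
have := failure_mass e0 M0 eta0 hT gQ; rewrite -/Z.
have := sum_mass p_pmf T.
by rewrite (bigID (fun s : T.-tuple (assignment dom) =>
  `[< exists n : 'I_T.+1, validates (tnth Qs) (e + e) s n >]))/=; lra.
Qed.

End Validation.

(** * From finite horizons to the stopped stream *)

Lemma take_mktuple (A : Type) (f : nat -> A) T n : (n <= T)%N ->
  take n [tuple f t | t < T] = mkseq f n.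
Proof.
move=> nT; have -> : tval [tuple f t | t < T] = mkseq f T.
  by rewrite /= (map_comp f val) val_enum_ord.
by rewrite /mkseq -map_take take_iota (minn_idPl nT).
Qed.

Theorem theorem4 (R : realType) (V : finType) (dom : V -> finType)
    (p : assignment dom -> R) (hp : is_pmf p)
    (sq : legal_query p -> R) (hsq : is_pmf sq)
    (B : bayes_net R dom) (Bq : query dom -> R) (hBq : net_answers B Bq)
    (eps delta : R) (heps : 0 < eps < 1) (hdelta : 0 < delta < 1)
    (d : measure_display) (Omega : measurableType d)
    (P : probability Omega R)
    (Q : 'I_(M_SQ eps delta) -> Omega -> legal_query p)
    (D : nat -> Omega -> assignment dom)
    (hQ : forall i, has_law P (Q i) sq)
    (hD : forall t, has_law P (D t) p)
    (hQD : mutually_independent P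
      (fun k : 'I_(M_SQ eps delta) + nat =>
        match k with
        | inl i => sigma_of (Q i)
        | inr t => sigma_of (D t)
        end)) :
  ((1 - delta)%:E <=
    P [set w | (exists n : nat,
        stops_at (fun i => lq (Q i w)) (M'_D eps delta) (D^~ w) n /\
        `| empirical_err (fun i => lq (Q i w)) (mkseq (D^~ w) n) Bq
           - err sq Bq | < eps)%R ])%E.
Proof.
have [e0 _] := andP heps; have [delta0 _] := andP hdelta.
have Bq01 q : 0 <= Bq q <= 1 by have [] := hBq q.
have m0 := M'_D_gt0 heps hdelta.
have M0 : (0 < M_SQ eps delta)%N by rewrite (leq_trans _ (M_SQ_ge2 heps hdelta)).
set m := M'_D eps delta in m0 *.
set A := [set w | _].
pose success T (Qs : (M_SQ eps delta).-tuple (legal_query p))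
    (s : T.-tuple (assignment dom)) :=
  `[< exists n : 'I_T.+1, validates sq Bq m (tnth Qs) (eps / 2 + eps / 2) s n >].
pose AT T := [set w |
  success T [tuple Q i w | i < M_SQ eps delta] [tuple D t w | t < T]].
have ATP T w : AT T w <-> exists2 n : nat, (n <= T)%N &
    (stops_at (fun i => lq (Q i w)) m (D^~ w) n /\
     `|empirical_err (fun i => lq (Q i w)) (mkseq (D^~ w) n) Bq - err sq Bq|
       < eps).
  have QE : (fun i => lq (tnth [tuple Q i w | i < M_SQ eps delta] i)) =
      (fun i => lq (Q i w)) by apply/funext => i; rewrite tnth_mktuple.
  have takeE n : (n <= T)%N -> take n [tuple D t w | t < T] = mkseq (D^~ w) n.
    exact: (@take_mktuple _ (D^~ w)).
  rewrite /AT/= /success; split.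
    move=> /asboolP[n]; have nT : (n <= T)%N by rewrite -ltnS.
    rewrite /validates QE -splitr takeE// => -[hn hk herr].
    exists n => //; split=> //; split=> // k kn.
    by rewrite -takeE ?(leq_trans (ltnW kn))//; exact: hk.
  move=> [n nT [[hn hk] herr]]; apply/asboolP; exists (Ordinal (nT : n < T.+1)%N).
  rewrite /validates QE -splitr/= takeE//; split=> // k kn.
  by rewrite takeE ?(leq_trans (ltnW kn))//; exact: hk.
(* A countable union of events decided by finitely many observations, hence measurable. *)
have AE : A = \bigcup_T AT T.
  apply/seteqP; split => w.
    by move=> [n hn]; exists n => //; apply/ATP; exists n.
  by move=> [T _ /ATP[n _ hn]]; exists n.
have obs T := prob_observations hQ hD hQD (success T).
have mAT T : measurable (AT T) := (obs T).1.
have mA : measurable A by rewrite AE; exact: bigcupT_measurable.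
have PA eta : 0 < eta -> ((1 - delta - eta)%:E <= P A)%E.
  move=> eta0.
  (* The slack [eta] pays for not having stopped by time T, shared equally among the sampled
     queries. *)
  have eta0' : 0 < eta / (M_SQ eps delta)%:R by rewrite divr_gt0 ?ltr0n.
  have [T hT] := few_matches_vanish hp m eta0'.
  apply: (@le_trans _ _ (P (AT T))); last first.
    by apply: le_measure; rewrite ?inE// AE; exact: bigcup_sup.
  rewrite (obs T).2 lee_fin.
  have e20 : 0 < eps / 2 by rewrite divr_gt0.
  apply: le_trans (validation_mass hp hsq Bq01 m0 e20 M0 (ltW eta0') hT).
  have := query_budget heps hdelta; have := data_budget heps hdelta.
  rewrite -/m (mulrDr _ (4 * _)) [_ * (eta / _)]mulrC divfK ?pnatr_eq0 -?lt0n//.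
  lra.
have PAfin : P A \is a fin_num by exact: fin_num_measure.
rewrite -(fineK PAfin) lee_fin; apply/ler_addgt0Pl => eta /PA.
by rewrite -(fineK PAfin) lee_fin; lra.
Qed.
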